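(* The unimodular simply connected Lie groups $S_1^{a,c,d}$ and $S_2^{a,c}$, with $a+c=0$, admit lattices for some values of the parameters, including $S_1^{0,0,d}$ for a countable number of $d>1$ and $S_2^{0,0}$.
   Context: A lattice in a simply connected solvable Lie group $G$ is a discrete subgroup $\Gamma$ with $\Gamma\backslash G$ compact. For $A\in\mathfrak{gl}(11,\mathbb{R})$, the simply connected Lie group with Lie algebra $\mathbb{R}e_0\ltimes_A\mathbb{R}^{11}$ ($\mathbb{R}^{11}$ an abelian ideal, $[e_0,v]=Av$) is $\mathbb{R}\times\mathbb{R}^{11}$ with product $(t,v)(s,w)=(t+s,v+e^{tA}w)$. Put $$K(a,b)=\begin{bmatrix}a&-b&0&0\\ b&a&0&0\\ 0&0&a&b\\ 0&0&-b&a\end{bmatrix}$$ and let $\oplus$ denote block diagonal sum, $0_3$ the $3\times3$ zero matrix. $S_1^{a,c,d}$ ($a,c\in\mathbb{R}$, $d>1$) is the simply connected Lie group corresponding to $A=0_3\oplus K(a,1)\oplus K(c,d)$, and $S_2^{a,c}$ (with $0\le a\le c$, or $a<0<c$ and $|a|\le|c|$) is the one corresponding to $A=0_3\oplus K(a,1)\oplus K(c,1)$. *)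

(* Defs.v *)
From mathcomp Require Import all_boot all_order all_algebra generic_quotient.
From mathcomp Require Import all_classical all_reals all_analysis.

Set Implicit Arguments.
Unset Strict Implicit.
Unset Printing Implicit Defensive.

Import Order.TTheory GRing.Theory Num.Theory.
Import numFieldNormedType.Exports.

Local Open Scope classical_set_scope.
Local Open Scope ring_scope.
Local Open Scope quotient_scope.

Definition expmx {R : realType} {n : nat} (A : 'M[R]_n) : 'M[R]_n :=
  limn (series (fun k : nat => k`!%:R^-1 *: A ^+ k)).

(* The simply connected Lie group with Lie algebra R e_0 |x_A R^n is the space
   R * R^n with the operations aa_one, aa_mul A, aa_inv A. *)
Notation aa_group R n := (R * 'cV[R]_n)%type.

Section Group.
Context {R : realType} {n : nat} (A : 'M[R]_n).

Definition aa_one : aa_group R n := (0, 0).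

Definition aa_mul (g h : aa_group R n) : aa_group R n :=
  (g.1 + h.1, g.2 + expmx (g.1 *: A) *m h.2).

Definition aa_inv (g : aa_group R n) : aa_group R n :=
  (- g.1, - (expmx (- g.1 *: A) *m g.2)).

Definition aa_subgroup (Gamma : set (aa_group R n)) : Prop :=
  [/\ Gamma aa_one,
      forall g h, Gamma g -> Gamma h -> Gamma (aa_mul g h)
    & forall g, Gamma g -> Gamma (aa_inv g)].

(* The coset Gamma g, an element of Gamma\G. *)
Definition aa_coset (Gamma : set (aa_group R n)) (g : aa_group R n) :
    set (aa_group R n) :=
  [set aa_mul gamma g | gamma in Gamma].

Definition same_coset (Gamma : set (aa_group R n)) : rel (aa_group R n) :=
  fun g h => `[< aa_coset Gamma g = aa_coset Gamma h >].

Lemma same_coset_refl (Gamma : set (aa_group R n)) :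
  reflexive (same_coset Gamma).
Proof. by move=> g; apply/asboolP. Qed.

Lemma same_coset_sym (Gamma : set (aa_group R n)) :
  symmetric (same_coset Gamma).
Proof. by move=> g h; apply/asboolP/asboolP. Qed.

Lemma same_coset_trans (Gamma : set (aa_group R n)) :
  transitive (same_coset Gamma).
Proof. by move=> h g k /asboolP gh /asboolP hk; apply/asboolP; rewrite gh. Qed.

Definition coset_equiv (Gamma : set (aa_group R n)) :
    equiv_rel (aa_group R n) :=
  EquivRel (same_coset Gamma) (same_coset_refl Gamma) (same_coset_sym Gamma)
    (@same_coset_trans Gamma).

Definition coset_space (Gamma : set (aa_group R n)) : topologicalType :=
  quotient_topology {eq_quot (coset_equiv Gamma)}.

Definition is_lattice (Gamma : set (aa_group R n)) : Prop :=
  [/\ aa_subgroup Gamma,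
      (* Gamma is discrete *)
      Gamma `<=` isolated Gamma
    & compact [set: coset_space Gamma]].

Definition admits_lattice : Prop :=
  exists Gamma : set (aa_group R n), is_lattice Gamma.

(* The Lie algebra R e_0 |x_A R^n in coordinates: index 0 is e_0, the other
   ones are R^n, and [e_0, v] = A v. *)
Definition aa_bracket (x y : 'cV[R]_(1 + n)) : 'cV[R]_(1 + n) :=
  col_mx 0 (usubmx x 0 0 *: (A *m dsubmx y) - usubmx y 0 0 *: (A *m dsubmx x)).

Definition aa_ad (x : 'cV[R]_(1 + n)) : 'M[R]_(1 + n) :=
  \matrix_(i, j) aa_bracket x (delta_mx j 0) i 0.

(* Unimodularity of a connected Lie group is read on its Lie algebra. *)
Definition unimodular : Prop := forall x : 'cV[R]_(1 + n), \tr (aa_ad x) = 0.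

End Group.

Section Families.
Context {R : realType}.

Definition Kmx (a b : R) : 'M[R]_4 :=
  \matrix_(i < 4, j < 4)
    (nth [::] [:: [:: a; - b;   0; 0];
                  [:: b;   a;   0; 0];
                  [:: 0;   0;   a; b];
                  [:: 0;   0; - b; a]] i)`_j.

(* The matrices A defining S_1^{a,c,d} and S_2^{a,c}. *)
Definition S1 (a c d : R) : 'M[R]_11 :=
  block_mx (0 : 'M[R]_3) 0 0 (block_mx (Kmx a 1) 0 0 (Kmx c d)).

Definition S2 (a c : R) : 'M[R]_11 :=
  block_mx (0 : 'M[R]_3) 0 0 (block_mx (Kmx a 1) 0 0 (Kmx c 1)).

Definition S2_param (a c : R) : Prop :=
  (0 <= a <= c) \/ (a < 0 < c /\ `|a| <= `|c|).

End Families.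

(* Main.v *)
(* At t = 2 pi the rotation parts of exp(t A) disappear when d is an integer:
   exp(2 pi A) is the identity on R^3, the scalar l = e^(2 pi a) on the first
   R^4 and l^-1 on the second one.  This is the identity if a = 0; otherwise, if
   l + l^-1 = n is an integer, it is conjugate to I_3 plus four copies of the
   companion matrix of x^2 - n x + 1, which lies in SL_2(Z).  In both cases
   exp(2 pi A) P = P N with N in GL_11(Z), and {(2 pi k, P z)}, with k and z
   integral, is a lattice.  As S_2^{a,c} is S_1^{a,c,1}, the integers d >= 1
   and l + l^-1 = 3 provide all the examples. *)

Require Import Defs.
From mathcomp Require Import all_boot all_order all_algebra generic_quotient.
From mathcomp Require Import all_classical all_reals all_analysis.
From mathcomp Require Import ring lra zify.

Import Order.TTheory GRing.Theory Num.Theory.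
Import numFieldNormedType.Exports.
Local Open Scope classical_set_scope.
Local Open Scope ring_scope.
Local Open Scope quotient_scope.

(** * Topology of matrix spaces *)

Lemma linear_mx_continuous (R : realType) (m n p q : nat)
  (f : {linear 'M[R]_(m, n) -> 'M[R]_(p, q)}) : continuous f.
Proof.
have -> : f =
    (fun v => \sum_(i < m) \sum_(j < n) v i j *: f (delta_mx i j)) :> (_ -> _).
  apply/funext => v; rewrite {1}[v]matrix_sum_delta linear_sum.
  apply: eq_bigr => i _; rewrite linear_sum.
  by apply: eq_bigr => j _; rewrite linearZ.
apply: continuous_big; first exact: add_continuous.
move=> i _; apply: continuous_big; first exact: add_continuous.
move=> j _ v; apply: cvgZr_tmp; first exact: nbhs_filter.
exact: coord_continuous.
Qed.

Lemma compact_unit_cube (R : realType) (n : nat) :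
  compact [set v : 'cV[R]_n | forall i, 0 <= v i 0 <= 1].
Proof.
have cube : compact [set v : 'rV[R]_n | forall i, `[0 : R, 1]%classic (v 0 i)].
  apply: (@rV_compact _ _ (fun=> `[0 : R, 1]%classic)) => _.
  exact: segment_compact.
have := continuous_compact
  (continuous_subspaceT (@linear_mx_continuous R 1 n n 1 trmx)) cube.
congr (compact _); apply/seteqP; split=> [_ [v vI <-] i|v vI].
  by move: (vI i); rewrite /= in_itv /= mxE.
exists v^T; last by rewrite /= trmxK.
by move=> i; rewrite /= in_itv /= mxE.
Qed.

(** * Lattices from an integral conjugate of the exponential *)

Section Lattice.
Context {R : realType} {n : nat} {A P : 'M[R]_n.+1} {N : 'M[int]_n.+1} {t : R}.

Let E (k : int) := expmx ((k%:~R * t) *: A).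

Let Gamma : set (aa_group R n.+1) :=
  [set g | exists (k : int) (z : 'cV[int]_n.+1),
     g = (k%:~R * t, P *m map_mx intr z)].

(** The multiples of [t] act on the lattice spanned by the columns of [P] through the integral
    matrices [N ^ k], so [Gamma] is a semidirect product of Z and that lattice. *)
Lemma lattice_of_integral_conjugate :
  0 < t -> P \in unitmx -> N \in unitmx ->
  (forall k : int, expmx ((k%:~R * t) *: A) *m P = P *m map_mx intr (N ^ k)) ->
  admits_lattice A.
Proof.
move=> t_gt0 P_unit N_unit EP.
(* The additivity of [E] is inherited from the powers of [N] through the conjugation by [P]. *)
have EE k : E k = P *m map_mx intr (N ^ k) *m invmx P.
  by rewrite -EP mulmxK.
have E0 : E 0 = 1%:M by rewrite EE expr0z map_mx1 mulmx1 mulmxV.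
have ED k l : E (k + l) = E k *m E l.
  rewrite !EE exprzDr // map_mxM !mulmxA; congr (_ *m _ *m _).
  by rewrite -[RHS]mulmxA mulVmx // mulmx1.
have EPz k z : E k *m (P *m map_mx intr z) =
    P *m (map_mx intr (N ^ k *m z) : 'cV[R]_n.+1).
  by rewrite mulmxA EP map_mxM mulmxA.
have GM g h : Gamma g -> Gamma h -> Gamma (aa_mul A g h).
  move=> [k [z ->]] [l [w ->]]; exists (k + l), (z + N ^ k *m w).
  rewrite /aa_mul /= -/(E k) EPz -mulmxDr -map_mxD.
  by rewrite intrD mulrDl.
have GV g : Gamma g -> Gamma (aa_inv A g).
  move=> [k [z ->]]; exists (- k), (- (N ^ (- k) *m z)).
  rewrite /aa_inv /= -mulNr -intrN -/(E (- k)) EPz.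
  by rewrite map_mxN mulmxN.
(* The two left factors are taken in [Gamma] because [E] is known to be multiplicative only at
   integral multiples of [t]; the third one is arbitrary. *)
have mulA g h x : Gamma g -> Gamma h ->
    aa_mul A g (aa_mul A h x) = aa_mul A (aa_mul A g h) x.
  move=> [k [z ->]] [l [w ->]]; rewrite /aa_mul /= addrA; congr (_, _).
  rewrite -mulrDl -intrD -/(E k) -/(E l) -/(E (k + l)) ED.
  by rewrite mulmxDr addrA !mulmxA.
have mulKV g x : Gamma g -> aa_mul A (aa_inv A g) (aa_mul A g x) = x.
  move=> Gg; rewrite mulA; [|exact: GV|exact: Gg].
  case: Gg => k [z ->]; case: x => s v; rewrite /aa_mul /aa_inv /=.
  by move: E0; rewrite /E mul0r !addNr => ->; rewrite mul1mx !add0r.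
exists Gamma; split.
- split=> //.
  by exists 0, 0; rewrite mul0r map_mx0 mulmx0.
- move=> g Gg; split; first exact/mem_set.
  case: Gg => k [z ->].
  pose f (v : 'cV[R]_n.+1) := invmx P *m v.
  have fc : continuous f.
    exact: (@linear_mx_continuous R _ _ _ _ (mulmx (invmx P))).
  (* The first coordinates of [Gamma] are spaced by [t], and in the basis [P] the second ones are
     integral: open balls of radius [t] and 1 contain no other point of [Gamma]. *)
  pose V := ball (k%:~R * t) t : set R.
  pose W := f @^-1` ball (f (P *m map_mx intr z)) 1.
  exists (V `*` W).
    exists (V, W) => //; split; first exact: nbhsx_ballx.
    exact/fc/nbhsx_ballx.
  apply/seteqP; split=> [[s v] [[/= kl zw] [l [w [sE vE]]]]|_ ->]; last first.
    by split; [split; exact: ballxx|exists k, z].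
  move: kl zw; rewrite {}sE {}vE /V /W /= -ball_normE /= -mulrBl.
  rewrite normrM (gtr0_norm t_gt0) gtr_pMl // -intrB -intr_norm.
  rewrite (_ : 1 = 1%:~R) // ltr_int => kl.
  have {kl} -> : l = k by lia.
  rewrite /f !mulKmx // => -[_ zw]; congr (_, _ *m map_mx _ _).
  apply/matrixP => i j; move: (zw i j).
  rewrite -ball_normE /= !mxE -intrB -intr_norm (_ : 1 = 1%:~R) // ltr_int.
  lia.
- have PC : continuous (mulmx P : 'cV[R]_n.+1 -> 'cV[R]_n.+1).
    exact: (@linear_mx_continuous R _ _ _ _ (mulmx P)).
  (* The quotient is the image of this compact set under the continuous projection. *)
  have K_compact := compact_setX (@segment_compact R 0 t)
    (continuous_compact (continuous_subspaceT PC) (@compact_unit_cube R n.+1)).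
  have := continuous_compact (continuous_subspaceT
    (@pi_continuous _ {eq_quot (coset_equiv A Gamma)})) K_compact.
  congr (compact _); apply/seteqP; split=> // q _ /=.
  move: (reprK q); case: (repr q) => s v <-.
  have floor_cube (u : 'cV[R]_n.+1) i :
      0 <= (map_mx intr (\col_i - Num.floor (u i 0)) + u) i 0 <= 1.
    rewrite !mxE intrN; have /andP[] := floor_itv (u i 0).
    by rewrite intrD => ? ?; apply/andP; split; lra.
  (* Subtracting integer parts moves (s, v) into [0, t] x P [0, 1]^n. *)
  pose k := Num.floor (s / t).
  (* Left multiplication by an element over [- k] applies [E (- k)] to [v]; [u] holds the
     coordinates of the result in the basis [P]. *)
  pose u := invmx P *m (E (- k) *m v).
  pose z : 'cV[int]_n.+1 := \col_i - Num.floor (u i 0).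
  exists (aa_mul A ((- k)%:~R * t, P *m map_mx intr z) (s, v)).
    split=> /=.
      rewrite in_itv /= intrN.
      have /andP[] := floor_itv (s / t).
      rewrite ler_pdivlMr // ltr_pdivrMr // -/k intrD mulrDl => ? ?.
      by apply/andP; split; lra.
    exists (map_mx intr z + u); last first.
      by rewrite mulmxDr /u mulKVmx.
    exact: floor_cube.
  set g := (_ * t, _); have Gg : Gamma g by exists (- k), z.
  apply/eqmodP/asboolP/seteqP; split=> [_ [h Gh <-]|_ [h Gh <-]].
    by exists (aa_mul A h g); [exact: GM|rewrite mulA].
  exists (aa_mul A h (aa_inv A g)); first by apply: GM => //; exact: GV.
  by rewrite -mulA ?mulKV //; exact: GV.
Qed.
End Lattice.

(** * Exponential generating series and the complex exponential *)

Section ExponentialSeries.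
Context {R : realType}.

Definition eseries (c : nat -> R) (x : R) := pseries (fun k => c k / k`!%:R) x.

(** Termwise comparison with [C] times the exponential series at [M * |x|]. *)
Lemma is_cvg_eseries (c : nat -> R) (C M x : R) :
  (forall k, `|c k| <= C * M ^+ k) -> cvgn (eseries c x).
Proof.
move=> cM; apply: normed_cvg.
have le (k : nat) : `|c k / k`!%:R * x ^+ k| <= C * exp_coeff (M * `|x|) k.
  rewrite /exp_coeff /= !normrM normfV normrX exprMn (ger0_norm (ler0n _ _)).
  rewrite [leRHS](_ : _ = C * M ^+ k / k`!%:R * `|x| ^+ k); last by ring.
  by rewrite ler_wpM2r ?exprn_ge0 // ler_wpM2r ?invr_ge0.
apply: (series_le_cvg _ _ le) => [k|k|]; first exact: normr_ge0.
  exact: le_trans (normr_ge0 _) (le k).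
exact/is_cvg_seriesZ/is_cvg_series_exp_coeff.
Qed.

(** With the factor [1 / k!], differentiation is a shift of [c]. A shift keeps a geometric bound, so
    the series and its first two derivatives converge at [|x| + 1], beyond [x]. *)
Lemma is_derive_eseries (c : nat -> R) (C M x : R) :
  (forall k, `|c k| <= C * M ^+ k) ->
  is_derive x 1 (fun x => limn (eseries c x))
    (limn (eseries (fun k => c k.+1) x)).
Proof.
move=> cM.
have shift (u : nat -> R) :
    pseries_diffs (fun k => u k / k`!%:R) = (fun k => u k.+1 / k`!%:R).
  apply/funext => k; rewrite /pseries_diffs factS natrM invfM.
  by rewrite mulrCA mulVKf ?pnatr_eq0.
have cM1 k : `|c k.+1| <= C * M * M ^+ k by rewrite -mulrA -exprS.
have cM2 k : `|c k.+2| <= C * M * M * M ^+ k by rewrite -!mulrA -!exprS.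
have := @pseries_snd_diffs R (fun k => c k / k`!%:R) (`|x| + 1) x.
rewrite !shift; apply; [exact: is_cvg_eseries cM|exact: is_cvg_eseries cM1|
  exact: is_cvg_eseries cM2|].
by rewrite [ltRHS]ger0_norm ?ltrDl // addr_ge0.
Qed.

Lemma eseries0 (c : nat -> R) : limn (eseries c 0) = c 0.
Proof.
(* The partial sum of index 0 is empty; all the later ones equal [c 0]. *)
apply: cvg_lim => //; rewrite -(cvg_shiftn 1) /=.
rewrite (_ : (fun _ => _) = fun=> c 0); first exact: cvg_cst.
apply/funext => k; rewrite addn1 /eseries /pseries /series /=.
rewrite big_nat_recl // big1 => [|i _]; last by rewrite expr0n mulr0.
by rewrite fact0 divr1 expr0 mulr1 addr0.
Qed.

(* The real and imaginary parts of (a + i b)^k. *)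
Fixpoint cpow (a b : R) (k : nat) : R * R :=
  if k is k'.+1 then
    (a * (cpow a b k').1 - b * (cpow a b k').2,
     b * (cpow a b k').1 + a * (cpow a b k').2)
  else (1, 0).

(** The l^1 norm is submultiplicative on the complex numbers. This is the geometric bound that the
    series above require. *)
Lemma cpow_bound (a b : R) (k : nat) :
  `|(cpow a b k).1| + `|(cpow a b k).2| <= (`|a| + `|b|) ^+ k.
Proof.
elim: k => [|k IH] /=; first by rewrite normr1 normr0 addr0.
apply: (@le_trans _ _
  ((`|a| + `|b|) * (`|(cpow a b k).1| + `|(cpow a b k).2|))).
  have := ler_normB (a * (cpow a b k).1) (b * (cpow a b k).2).
  have := ler_normD (b * (cpow a b k).1) (a * (cpow a b k).2).
  rewrite !normrM; lra.
by rewrite exprS ler_wpM2l // addr_ge0.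
Qed.

(** As functions of [x], the two sums satisfy (U + i V)' = (a + i b) (U + i V) with value 1 at 0,
    which determines them. *)
Lemma cvg_cexp (a b : R) :
  (eseries (fun k => (cpow a b k).1) 1 @ \oo --> expR a * cos b) /\
  (eseries (fun k => (cpow a b k).2) 1 @ \oo --> expR a * sin b).
Proof.
pose c k := (cpow a b k).1; pose d k := (cpow a b k).2.
pose M := `|a| + `|b|.
have cM k : `|c k| <= 1 * M ^+ k.
  by rewrite mul1r; apply: le_trans (cpow_bound a b k); rewrite lerDl.
have dM k : `|d k| <= 1 * M ^+ k.
  by rewrite mul1r; apply: le_trans (cpow_bound a b k); rewrite lerDr.
have cvg_c x := @is_cvg_eseries _ _ _ x cM.
have cvg_d x := @is_cvg_eseries _ _ _ x dM.
pose U x := limn (eseries c x); pose V x := limn (eseries d x).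
have lin (p q x : R) :
    limn (eseries (fun k => p * c k + q * d k) x) = p * U x + q * V x.
  apply: cvg_lim => //.
  rewrite (_ : eseries _ _ = p \*: eseries c x + q \*: eseries d x).
    by apply: cvgD; apply: cvgZl_tmp; [exact: cvg_c|exact: cvg_d].
  apply/funext => n; rewrite /eseries /pseries /series /= !fctE /=.
  rewrite !scaler_sumr -big_split /=; apply: eq_bigr => i _.
  by rewrite /GRing.scale /=; ring.
have dU (x : R) : is_derive x 1 U (a * U x - b * V x).
  have := @is_derive_eseries c 1 M x cM.
  rewrite (_ : (fun k => c k.+1) = fun k => a * c k + (- b) * d k).
    by rewrite lin mulNr.
  by apply/funext => k; rewrite mulNr.
have dV (x : R) : is_derive x 1 V (b * U x + a * V x).
  have := @is_derive_eseries d 1 M x dM.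
  by rewrite -lin.
(* F + i G is e^(- (a + i b) x) (U + i V). *)
pose F x := expR (- a * x) * (U x * cos (b * x) + V x * sin (b * x)).
pose G x := expR (- a * x) * (V x * cos (b * x) - U x * sin (b * x)).
have F1 : F 1 = F 0.
  apply: is_derive_0_is_cst => x; rewrite /F.
  apply: is_derive_eq; rewrite /GRing.scale /=; ring.
have G1 : G 1 = G 0.
  apply: is_derive_0_is_cst => x; rewrite /G.
  apply: is_derive_eq; rewrite /GRing.scale /=; ring.
have U0 : U 0 = 1 by rewrite /U eseries0.
have V0 : V 0 = 0 by rewrite /V eseries0.
move: F1 G1; rewrite /F /G U0 V0 !mulr0 !mulr1 expR0 cos0 sin0.
rewrite expRN => F1 G1.
have ea : expR a != 0 by rewrite gt_eqF // expR_gt0.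
have {}F1 : U 1 * cos b + V 1 * sin b = expR a.
  by apply: (mulfI (invr_neq0 ea)); rewrite F1 mulVf //; ring.
have {}G1 : V 1 * cos b - U 1 * sin b = 0.
  by apply: (mulfI (invr_neq0 ea)); rewrite G1; ring.
(* [F1] and [G1] say that the rotation of angle [- b] sends (U 1, V 1) to (e^a, 0); the inverse
   rotation gives both values. *)
have -> : expR a * cos b = U 1.
  transitivity (U 1 * (cos b ^+ 2 + sin b ^+ 2)
    + sin b * (V 1 * cos b - U 1 * sin b)); first by rewrite -F1; ring.
  by rewrite G1 cos2Dsin2; ring.
have -> : expR a * sin b = V 1.
  transitivity (V 1 * (cos b ^+ 2 + sin b ^+ 2)
    - cos b * (V 1 * cos b - U 1 * sin b)); first by rewrite -F1; ring.
  by rewrite G1 cos2Dsin2; ring.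
by split; [exact: cvg_c|exact: cvg_d].
Qed.
End ExponentialSeries.

(** * The exponential of the matrices of the two families *)

Section MatrixExponential.
Context {R : realType}.
Implicit Types (a b c d w p q r s x : R).

(** [Kmx a b] acts as a + i b on the first plane and as its conjugate on the second, so products
    follow complex multiplication. *)
Lemma KmxM a b c d :
  Kmx a b *m Kmx c d = Kmx (a * c - b * d) (b * c + a * d).
Proof.
apply/matrixP => -[[|[|[|[|?]]]] ?] // [[|[|[|[|?]]]] ?] //;
  by rewrite !mxE !big_ord_recl big_ord0 !mxE /=; ring.
Qed.

Lemma Kmx_scalar a : Kmx a 0 = a%:M.
Proof.
apply/matrixP => -[[|[|[|[|?]]]] ?] // [[|[|[|[|?]]]] ?] //;
  by rewrite !mxE /= ?mulr1n ?mulr0n ?oppr0.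
Qed.

Lemma KmxD a b c d : Kmx a b + Kmx c d = Kmx (a + c) (b + d).
Proof.
apply/matrixP => -[[|[|[|[|?]]]] ?] // [[|[|[|[|?]]]] ?] //;
  by rewrite !mxE /=; ring.
Qed.

Lemma KmxZ x a b : x *: Kmx a b = Kmx (x * a) (x * b).
Proof.
apply/matrixP => -[[|[|[|[|?]]]] ?] // [[|[|[|[|?]]]] ?] //;
  by rewrite !mxE /=; ring.
Qed.

(** A copy of the algebra R x C x C, with coordinates w, p + i q and r + i s, containing [S1] and
    its exponentials. *)
Definition Bmx w p q r s : 'M[R]_11 :=
  block_mx (w%:M : 'M[R]_3) 0 0 (block_mx (Kmx p q) 0 0 (Kmx r s)).

Lemma BmxM w p q r s w' p' q' r' s' :
  Bmx w p q r s *m Bmx w' p' q' r' s' =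
  Bmx (w * w') (p * p' - q * q') (q * p' + p * q')
      (r * r' - s * s') (s * r' + r * s').
Proof.
rewrite /Bmx (@mulmx_block _ 3 8 3 8 3 8) (@mulmx_block _ 4 4 4 4 4 4).
by rewrite !mul0mx !mulmx0 !add0r !addr0 -scalar_mxM !KmxM.
Qed.

Lemma BmxD w p q r s w' p' q' r' s' :
  Bmx w p q r s + Bmx w' p' q' r' s' =
  Bmx (w + w') (p + p') (q + q') (r + r') (s + s').
Proof.
rewrite /Bmx (@add_block_mx _ 3 8 3 8) (@add_block_mx _ 4 4 4 4).
by rewrite !addr0 !KmxD raddfD.
Qed.

Lemma BmxZ x w p q r s :
  x *: Bmx w p q r s = Bmx (x * w) (x * p) (x * q) (x * r) (x * s).
Proof.
rewrite /Bmx (@scale_block_mx _ 3 8 3 8) (@scale_block_mx _ 4 4 4 4).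
by rewrite !scaler0 !KmxZ scale_scalar_mx.
Qed.

Lemma S1_Bmx a c d : S1 a c d = Bmx 0 a 1 c d.
Proof. by rewrite /S1 /Bmx raddf0. Qed.

(** On R^3, [(cpow 0 0 k).1] stands for 0^k: it is 1 at [k = 0] and 0 afterwards. *)
Lemma exp_Bmx a b c d (k : nat) :
  Bmx 0 a b c d ^+ k =
  Bmx (cpow 0 0 k).1 (cpow a b k).1 (cpow a b k).2
      (cpow c d k).1 (cpow c d k).2.
Proof.
elim: k => [|k IH].
  rewrite expr0 /Bmx /= !Kmx_scalar.
  by rewrite -!(@scalar_mx_block _ _ _ 1).
rewrite exprS IH; apply: etrans (BmxM _ _ _ _ _ _ _ _ _ _) _.
by congr (Bmx _ _ _ _ _) => /=; rewrite !mul0r subr0.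
Qed.

Lemma expmx_Bmx a b c d :
  expmx (Bmx 0 a b c d) =
  Bmx 1 (expR a * cos b) (expR a * sin b) (expR c * cos d) (expR c * sin d).
Proof.
(* Writing [Bmx] on constant matrices reduces the matrix limit to the limits of five scalar
   series. *)
have decomp w p q r s : Bmx w p q r s =
    w *: Bmx 1 0 0 0 0 + p *: Bmx 0 1 0 0 0 + q *: Bmx 0 0 1 0 0
    + r *: Bmx 0 0 0 1 0 + s *: Bmx 0 0 0 0 1.
  by rewrite !BmxZ !BmxD; congr Bmx; ring.
apply: (cvg_lim (@norm_hausdorff _ _)).
pose Re x y := eseries (fun k => (cpow x y k).1) 1.
pose Im x y := eseries (fun k => (cpow x y k).2) 1.
rewrite (_ : series _ =
    fun n => Bmx (Re 0 0 n) (Re a b n) (Im a b n) (Re c d n) (Im c d n)).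
  rewrite decomp; under eq_fun do rewrite decomp.
  have [w0 _] := @cvg_cexp R 0 0; rewrite expR0 cos0 mulr1 in w0.
  have [re1 im1] := @cvg_cexp R a b; have [re2 im2] := @cvg_cexp R c d.
  by do !apply: cvgD; apply: cvgZr_tmp.
apply/funext => n; rewrite /Re /Im /eseries /pseries /series /=.
elim: n => [|n IH].
  rewrite !big_nil /Bmx !Kmx_scalar.
  by rewrite -!(@scalar_mx_block _ _ _ 0) raddf0.
rewrite !big_nat_recr //= IH exp_Bmx BmxZ BmxD.
by rewrite !expr1n !mulr1 ![_^-1 * _]mulrC.
Qed.

Lemma expmx_S1 x a c d :
  expmx (x *: S1 a c d) =
  Bmx 1 (expR (x * a) * cos x) (expR (x * a) * sin x)
        (expR (x * c) * cos (x * d)) (expR (x * c) * sin (x * d)).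
Proof. by rewrite S1_Bmx BmxZ mulr0 mulr1 expmx_Bmx. Qed.

End MatrixExponential.

(** * Unimodularity *)

(** For the splitting into R e_0 and R^n, ad x is block lower triangular with diagonal blocks 0 and
    x_0 A. *)
Lemma tr_aa_ad (R : realType) (n : nat) (A : 'M[R]_n) (x : 'cV[R]_(1 + n)) :
  \tr (aa_ad A x) = usubmx x 0 0 * \tr A.
Proof.
rewrite /mxtrace big_split_ord /= big_ord1 mxE col_mxEu mxE add0r mulr_sumr.
apply: eq_bigr => i _.
rewrite mxE /aa_bracket.
have -> : delta_mx (rshift 1 i) 0 = col_mx 0 (delta_mx i 0) :> 'cV[R]_(1 + n).
  apply/colP => k; rewrite mxE; case: (split_ordP k) => l ->.
    by rewrite col_mxEu !mxE; case: eqP => // /eqP; rewrite eq_lrshift.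
  by rewrite col_mxEd !mxE eq_rshift.
rewrite col_mxEd col_mxKu col_mxKd -colE !mxE; ring.
Qed.

Lemma unimodular_S1 (R : realType) (a c d : R) :
  a + c = 0 -> unimodular (S1 a c d).
Proof.
move=> ac0 x; rewrite tr_aa_ad /S1.
have trK p q : \tr (Kmx p q) = 4 * p :> R.
  by rewrite /mxtrace !big_ord_recl big_ord0 !mxE /=; ring.
rewrite (@mxtrace_block _ 3 8) (@mxtrace_block _ 4 4) raddf0 !trK.
by rewrite add0r -mulrDr ac0 !mulr0.
Qed.

(** * Two by two block matrices and their integral powers *)

Section BlockTwo.
Context {T : comUnitRingType}.
Implicit Types p q r s : T.

(** The Kronecker product of the two by two matrix (p, q; r, s) with I_4, extended by the identity
    in dimension 3; computations reduce to size two. *)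
Definition block2 p q r s : 'M[T]_11 :=
  block_mx (1%:M : 'M[T]_3) 0 0
    (block_mx (p%:M : 'M[T]_4) q%:M r%:M (s%:M : 'M[T]_4)).

Lemma block2M p q r s p' q' r' s' :
  block2 p q r s *m block2 p' q' r' s' =
  block2 (p * p' + q * r') (p * q' + q * s')
         (r * p' + s * r') (r * q' + s * s').
Proof.
rewrite /block2 (@mulmx_block _ 3 8 3 8 3 8) (@mulmx_block _ 4 4 4 4 4 4).
by rewrite !mul0mx !mulmx0 !add0r !addr0 mulmx1 -!scalar_mxM -!raddfD.
Qed.

Lemma block2_1 : block2 1 0 0 1 = 1%:M.
Proof.
by rewrite /block2 raddf0 -(@scalar_mx_block _ 4 4) -(@scalar_mx_block _ 3 8).
Qed.

(** The inverse is the adjugate of (p, q; r, s) divided by its determinant. *)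
Lemma block2_unit p q r s :
  p * s - q * r \is a GRing.unit -> block2 p q r s \in unitmx.
Proof.
move=> uD; set D := p * s - q * r in uD.
suff /mulmx1_unit[] // : block2 p q r s *m
    block2 (s / D) (- q / D) (- r / D) (p / D) = 1%:M by [].
rewrite block2M -block2_1; congr block2.
- by rewrite -(divrr uD); rewrite /D; ring.
- by ring.
- by ring.
- by rewrite -(divrr uD); rewrite /D; ring.
Qed.

End BlockTwo.

Lemma map_block2 (T T' : comUnitRingType) (f : {rmorphism T -> T'})
  (p q r s : T) :
  map_mx f (block2 p q r s) = block2 (f p) (f q) (f r) (f s).
Proof.
rewrite /block2 (@map_block_mx _ _ _ 3 8 3 8) (@map_block_mx _ _ _ 4 4 4 4).
by rewrite !map_scalar_mx !map_mx0 rmorph1.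
Qed.

Lemma exprz_intertwine {T : comUnitRingType} {n : nat} {D P M : 'M[T]_n.+1}
  (k : int) :
  D \in unitmx -> M \in unitmx -> D *m P = P *m M -> D ^ k *m P = P *m M ^ k.
Proof.
move=> uD uM DP.
have nat_case (j : nat) : D ^+ j *m P = P *m M ^+ j.
  elim: j => [|j IH]; first by rewrite !expr0 mul1mx mulmx1.
  by rewrite !exprSr -!mulmxE -mulmxA DP mulmxA IH -mulmxA.
case: k => j; first by rewrite -!exprnP.
rewrite NegzE -!exprnN.
have uDj : D ^+ j.+1 \in unitmx by exact: unitrX.
have uMj : M ^+ j.+1 \in unitmx by exact: unitrX.
(* For a negative exponent, M^(j+1) is inserted together with its inverse, then moved across [P],
   where it becomes D^(j+1) and cancels. *)
rewrite -[LHS](mulmxK uMj) -(mulmxA _ P) -nat_case mulmxA.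
by rewrite (mulVmx uDj) mul1mx.
Qed.

(** * Exponentials at multiples of 2 pi and the resulting lattices *)

Lemma expRM_int (R : realType) (k : int) (x : R) :
  expR (k%:~R * x) = expR x ^ k.
Proof.
case: k => j; first by rewrite -pmulrn expRM_natl.
by rewrite NegzE intrN mulNr expRN -pmulrn expRM_natl -exprnN.
Qed.

Lemma cos_2pi_int (R : realType) (k : int) : cos (k%:~R * (pi *+ 2)) = 1 :> R.
Proof.
wlog [j ->] : k / exists j : nat, k = j%:Z.
  move=> W; case: k => j; first by apply: W; exists j.
  by rewrite NegzE intrN mulNr cosN; apply: W; exists j.+1.
by rewrite -pmulrn mulr_natl -(add0r (_ *+ j)) (periodicn (@cosD2pi R)) cos0.
Qed.

Lemma sin_2pi_int (R : realType) (k : int) : sin (k%:~R * (pi *+ 2)) = 0 :> R.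
Proof.
have := cos2Dsin2 (k%:~R * (pi *+ 2) : R).
rewrite cos_2pi_int expr1n => /(canRL (addKr _)).
by rewrite addrC subrr => /eqP; rewrite sqrf_eq0 => /eqP.
Qed.

Lemma block2_exprz (F : fieldType) (x y : F) (k : int) :
  x != 0 -> y != 0 -> block2 x 0 0 y ^ k = block2 (x ^ k) 0 0 (y ^ k).
Proof.
move=> x0 y0.
have nat_case (u v : F) (j : nat) :
    block2 u 0 0 v ^+ j = block2 (u ^+ j) 0 0 (v ^+ j).
  elim: j => [|j IH]; first by rewrite !expr0 block2_1.
  rewrite !exprS IH; apply: etrans (block2M _ _ _ _ _ _ _ _) _.
  by rewrite !mulr0 !mul0r !addr0 add0r.
case: k => j; first by rewrite -!exprnP nat_case.
rewrite NegzE -!exprnN nat_case.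
have u0 : x ^+ j.+1 != 0 by rewrite expf_neq0.
have v0 : y ^+ j.+1 != 0 by rewrite expf_neq0.
have unit_uv : block2 (x ^+ j.+1) 0 0 (y ^+ j.+1) \in unitmx.
  by apply: block2_unit; rewrite mulr0 subr0 unitfE mulf_neq0.
apply: (mulrI unit_uv); rewrite divrr //; apply/esym.
apply: etrans (block2M _ _ _ _ _ _ _ _) _.
by rewrite !mulr0 !mul0r !addr0 add0r !mulfV // block2_1.
Qed.

(** The [block2] matrix is exp(2 pi A), so one relation with [N] yields, by taking powers, the
    relations at all multiples of 2 pi. *)
Lemma lattice_of_exponential (R : realType) (a : R) (m : nat)
  (P : 'M[R]_11) (N : 'M[int]_11) :
  let l := expR (pi *+ 2 * a) in
  P \in unitmx -> N \in unitmx ->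
  block2 l 0 0 l^-1 *m P = P *m map_mx intr N ->
  admits_lattice (S1 a (- a) m%:R).
Proof.
move=> l uP uN lP.
have l0 : l != 0 by rewrite gt_eqF // expR_gt0.
apply: (@lattice_of_integral_conjugate R 10 _ P N (pi *+ 2)) => // [|k].
  by rewrite mulrn_wgt0 // pi_gt0.
have uN' : (map_mx intr N : 'M[R]_11) \in unitmx.
  by rewrite unitmxE det_map_mx rmorph_unit // -unitmxE.
rewrite rmorphXz // -(exprz_intertwine k _ uN' lP); last first.
  by apply: block2_unit; rewrite mulr0 subr0 mulfV // unitr1.
congr (_ *m _).
rewrite block2_exprz ?invr_eq0 // expmx_S1.
set x := k%:~R * _.
(* Integrality of the second frequency makes its angle a multiple of 2 pi too. *)
have -> : x * m%:R = (k * m)%:~R * (pi *+ 2).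
  rewrite intrM /x; ring.
rewrite !cos_2pi_int !sin_2pi_int !mulr1 !mulr0.
by rewrite /Bmx /block2 !Kmx_scalar -!mulrA !expRM_int mulrN expRN raddf0.
Qed.

Lemma lattice_elliptic (R : realType) (m : nat) :
  admits_lattice (S1 (0 : R) 0 m%:R).
Proof.
rewrite -{2}(oppr0 R); apply: (@lattice_of_exponential _ _ _ 1%:M 1%:M).
- exact: unitmx1.
- exact: unitmx1.
- by rewrite mulr0 expR0 invr1 block2_1 map_mx1.
Qed.

(* The rows (1, l) and (1, l^-1) of P are left eigenvectors of the companion
   matrix N of x^2 - n x + 1 = (x - l)(x - l^-1), so diag(l, l^-1) P = P N. *)
Lemma lattice_hyperbolic (R : realType) (a : R) (m n : nat) :
  a != 0 -> expR (pi *+ 2 * a) + (expR (pi *+ 2 * a))^-1 = n%:R ->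
  admits_lattice (S1 a (- a) m%:R).
Proof.
move=> a0; set l := expR _ => ln.
have l0 : l != 0 by rewrite gt_eqF // expR_gt0.
apply: (@lattice_of_exponential _ _ _
  (block2 1 l 1 l^-1) (block2 0 (- 1) 1 n%:Z)).
(* The determinant l^-1 - l is nonzero, since [expR] is injective and [a] is nonzero. *)
- apply: block2_unit; rewrite mul1r mulr1 unitfE subr_eq0.
  rewrite /l -expRN (inj_eq (@expR_inj R)) -subr_eq0 -opprD oppr_eq0 -mulr2n.
  rewrite mulrn_eq0 /= mulf_eq0 negb_or a0 andbT mulrn_eq0 /=.
  by rewrite gt_eqF // pi_gt0.
- by apply: block2_unit; rewrite mul0r mulN1r opprK add0r unitr1.
- rewrite (map_block2 _ _ intr) !block2M -/l rmorph0 rmorph1 rmorphN1 /=.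
  by rewrite -pmulrn -ln; congr block2; field.
Qed.

(** The value (3 - q) / 2, with q the square root of 5, is the root of x^2 - 3 x + 1 below 1. Its
    logarithm is negative, as [S2_param a (- a)] demands of a nonzero [a]. *)
Lemma hyperbolic_parameter (R : realType) :
  exists2 a : R, a < 0 & expR (pi *+ 2 * a) + (expR (pi *+ 2 * a))^-1 = 3%:R.
Proof.
have pi2 : 0 < pi *+ 2 :> R by rewrite mulrn_wgt0 // pi_gt0.
pose q := Num.sqrt 5 : R.
have q2 : q ^+ 2 = 5 by rewrite sqr_sqrtr.
have q0 : 0 <= q by exact: sqrtr_ge0.
have q_lt3 : q < 3 by nra.
have q_gt1 : 1 < q by nra.
exists (ln ((3 - q) / 2) / (pi *+ 2)).
  by rewrite ltr_pdivrMr // mul0r ln_lt0 //; apply/andP; split; lra.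
rewrite mulrC divfK ?gt_eqF // lnK; last by rewrite posrE; lra.
apply: (@mulfI _ ((3 - q) / 2)); first by apply: lt0r_neq0; lra.
rewrite mulrDr divff; last by apply: lt0r_neq0; lra.
nra.
Qed.

Theorem proposition6p5 (R : realType) :
  (forall a c d : R, 1 < d -> a + c = 0 -> unimodular (S1 a c d)) /\
  (forall a c : R, S2_param a c -> a + c = 0 -> unimodular (S2 a c)) /\
  (exists a c d : R,
    [/\ 1 < d, a + c = 0, a != 0 & admits_lattice (S1 a c d)]) /\
  (exists a c : R,
    [/\ S2_param a c, a + c = 0, a != 0 & admits_lattice (S2 a c)]) /\
  (exists D : set R,
    [/\ (D #= [set: nat])%card, D `<=` [set d | 1 < d]
      & forall d, D d -> admits_lattice (S1 0 0 d)]) /\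
  admits_lattice (S2 (0 : R) 0).
Proof.
have [a a_lt0 ha] := hyperbolic_parameter R.
have a_neq0 : a != 0 by rewrite lt_eqF.
split; first by move=> ? ? ? _; exact: unimodular_S1.
(* [S2 a c] is [S1 a c 1] by definition. *)
split; first by move=> ? ? _; exact: (@unimodular_S1 _ _ _ 1).
split.
  exists a, (- a), 2%:R; split; rewrite ?subrr ?ltr1n //.
  exact: (lattice_hyperbolic _ _ _ 3).
split.
  exists a, (- a); split; rewrite ?subrr //.
    by right; rewrite a_lt0 oppr_gt0 a_lt0 normrN.
  exact: (lattice_hyperbolic _ _ 1 3).
split; last exact: (lattice_elliptic _ 1).
(* The integers from 2 on, so that [1 < d]. *)
exists (range (fun m : nat => m.+2%:R)); split.
- apply: inj_card_eq => m n _ _ /eqP.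
  by rewrite eqr_nat => /eqP[].
- by move=> _ [m _ <-] /=; rewrite ltr1n.
- by move=> _ [m _ <-]; exact: lattice_elliptic.
Qed.
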